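(* Let $K\hookrightarrow L$ be a simplicial pair and let $q\in\mathbb{N}$. Assume that $n_q^K<n_q^L$ and let $I_K^L=[n_q^L]\setminus[n_q^K]$. Then the matrix $\boldsymbol{\Delta}_{q,\mathrm{up}}^{K,L}$ of the $q$-th up persistent Laplacian is the Schur complement $$\boldsymbol{\Delta}_{q,\mathrm{up}}^{K,L}=\boldsymbol{\Delta}_{q,\mathrm{up}}^{L}\big/\boldsymbol{\Delta}_{q,\mathrm{up}}^{L}(I_K^L,I_K^L).$$
   Context: A simplicial complex $K$ over a finite totally ordered set $V$ is a collection of nonempty subsets of $V$ closed under taking nonempty subsets. $S_q^K$ is the set of $q$-simplices (elements of cardinality $q+1$) and $n_q^K=|S_q^K|$. Every complex $K$ carries a weight function $w^K:K\to(0,\infty)$, and $w_q^K$ is its restriction to $S_q^K$. For $\sigma\in S_q^K$, $[\sigma]$ is $\sigma$ oriented by the order of $V$. $C_q^K$ is the real vector space with basis $\{[\sigma]:\sigma\in S_q^K\}$ (and $C_{-1}^K=0$), with the inner product $\langle[\sigma],[\sigma']\rangle_{w_q^K}=\delta_{\sigma\sigma'}\,(w_q^K(\sigma))^{-1}$. The boundary operator is $\partial_q^K[v_0,\dots,v_q]=\sum_{i=0}^q(-1)^i[v_0,\dots,\hat v_i,\dots,v_q]$ for $q\geq 1$, and $\partial_0^K=0$. A simplicial pair $K\hookrightarrow L$ consists of simplicial complexes $K\subseteq L$ over the same ordered set $V$ with $w^K=w^L|_K$. Put $C_{q}^{L,K}=\{c\in C_q^L:\partial_q^L c\in C_{q-1}^K\}$,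 with the inner product restricted from $C_q^L$, and let $\partial_q^{L,K}:C_q^{L,K}\to C_{q-1}^K$ be the restriction of $\partial_q^L$. With $*$ denoting adjoints, the $q$-th up persistent Laplacian is the operator $\Delta_{q,\mathrm{up}}^{K,L}=\partial_{q+1}^{L,K}(\partial_{q+1}^{L,K})^*$ on $C_q^K$, and the $q$-th up Laplacian of $L$ is $\Delta_{q,\mathrm{up}}^L=\partial_{q+1}^L(\partial_{q+1}^L)^*$ on $C_q^L$. Write $[n]=\{1,\dots,n\}$. The $q$-simplices of $L$ are ordered as $\sigma_1,\dots,\sigma_{n_q^L}$ so that $S_q^K=\{\sigma_1,\dots,\sigma_{n_q^K}\}$; $\boldsymbol{\Delta}_{q,\mathrm{up}}^{K,L}$ and $\boldsymbol{\Delta}_{q,\mathrm{up}}^{L}$ are the matrices of the operators in the bases $([\sigma_i])_{i\le n_q^K}$ and $([\sigma_i])_{i\le n_q^L}$. For a matrix $M$, $M(I,J)$ is the submatrix with rows indexed by $I$ and columns by $J$. For an $n\times n$ matrix $M$ and index set $I\subseteq[n]$ with complement $I^c$, the (generalized) Schur complement is $M/M(I,I)=M(I^c,I^c)-M(I^c,I)\,M(I,I)^\dagger\,M(I,I^c)$, where $\dagger$ is the Moore–Penrose inverse. *)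

(* Defs.v *)
From HB Require Import structures.
From mathcomp Require Import all_boot all_order all_algebra.
From mathcomp Require Import boolp reals.

Set Implicit Arguments.
Unset Strict Implicit.
Unset Printing Implicit Defensive.

Import Order.TTheory GRing.Theory Num.Theory.
Local Open Scope ring_scope.

Section Adjoint.

Variables (R : realType) (U W : vectType R).
Variables (dU : {dot U for idfun}) (dW : {dot W for idfun}).

Definition is_adjoint (f : 'Hom(U, W)) (g : 'Hom(W, U)) :=
  forall u w, dW (f u) w = dU u (g w).

Lemma exists_adjoint f : exists g, is_adjoint f g.
Proof.
pose n := \dim {:U}; pose b := vbasis {:U}.
pose T : 'Hom(U, 'rV[R]_n) := linfun (fun x => \row_(i < n) dU b`_i x : 'rV[R]_n).
pose S : 'Hom(W, 'rV[R]_n) := linfun (fun w => \row_(i < n) dW (f b`_i) w : 'rV[R]_n).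
have TE x i : T x 0 i = dU b`_i x.
  rewrite /T; pose T0 x := \row_(i < n) dU b`_i x : 'rV[R]_n.
  have linT : linear T0.
    by move=> a u v; apply/rowP => j; rewrite !mxE linearD linearZ_LR.
  pose l := GRing.isLinear.Build _ _ _ _ T0 linT.
  pose T1 : {linear U -> 'rV[R]_n} := HB.pack T0 l.
  by rewrite -/T0 -[T0]/(T1 : U -> _) lfunE /= mxE.
have SE x i : S x 0 i = dW (f b`_i) x.
  rewrite /S; pose T0 x := \row_(i < n) dW (f b`_i) x : 'rV[R]_n.
  have linT : linear T0.
    by move=> a u v; apply/rowP => j; rewrite !mxE linearD linearZ_LR.
  pose l := GRing.isLinear.Build _ _ _ _ T0 linT.
  pose T1 : {linear W -> 'rV[R]_n} := HB.pack T0 l.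
  by rewrite -/T0 -[T0]/(T1 : W -> _) lfunE /= mxE.
have kerT : lker T == 0%VS.
  apply/lker0P => x y eqT; apply/eqP; rewrite -subr_eq0; apply/negPn/negP.
  move=> /(@neq0_dnorm_gt0 _ _ _ dU); rewrite {1}(coord_vbasis (memvf (x - y))).
  rewrite linear_sumlz big1 ?ltxx // => i _.
  rewrite linearZl_LR /= linearBr /= -!TE.
  by rewrite eqT subrr mulr0.
have imT : limg T = fullv.
  apply/eqP; rewrite eqEdim subvf limg_dim_eq ?(eqP kerT) ?capv0 //.
  by rewrite [in leqLHS]dimvf /dim /= mul1n.
exists (T^-1 \o S)%VF => u w.
rewrite (coord_vbasis (memvf u)) linear_sum !linear_sumlz; apply: eq_bigr => i _.
rewrite linearZ linearZl_LR [RHS]linearZl_LR /=; congr (_ * _).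
by rewrite -SE -TE comp_lfunE limg_lfunVK // imT memvf.
Qed.

Definition adjoint (f : 'Hom(U, W)) : 'Hom(W, U) := sval (cid (exists_adjoint f)).

Lemma adjointP f : is_adjoint f (adjoint f).
Proof. exact: svalP. Qed.

End Adjoint.

Section RestrictedDot.

Variables (R : realType) (U : vectType R) (dU : {dot U for idfun}) (W : {vspace U}).

Definition restr_dot (u v : subvs_of W) : R := dU (vsval u) (vsval v).

Lemma restr_dot_bilinear : bilinear_for *%R (idfun \; *%R) restr_dot.
Proof.
by split=> [v|u] a x y; rewrite /restr_dot linearD linearZ /= ?linearPl ?linearPr.
Qed.

HB.instance Definition _ :=
  bilinear_isBilinear.Build R _ _ _ _ _ restr_dot restr_dot_bilinear.

Lemma restr_dot_sym (u v : subvs_of W) :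
  restr_dot u v = (-1) ^+ false * idfun (restr_dot v u).
Proof. by rewrite /restr_dot [LHS]hermitian_subproof. Qed.

HB.instance Definition _ :=
  isHermitianSesquilinear.Build R _ false idfun restr_dot restr_dot_sym.

Lemma restr_dot_gt0 (u : subvs_of W) : u != 0 -> 0 < restr_dot u u.
Proof. by move=> u0; apply: neq0_dnorm_gt0; rewrite -val_eqE /= in u0. Qed.

HB.instance Definition _ := isDotProduct.Build R _ restr_dot restr_dot_gt0.

End RestrictedDot.

Section Matrices.

Variable R : realType.

Definition is_pinv m n (A : 'M[R]_(m, n)) (X : 'M[R]_(n, m)) :=
  [/\ A *m X *m A = A, X *m A *m X = X,
      (A *m X)^T = A *m X & (X *m A)^T = X *m A].

Lemma gram_unit r n (B : 'M[R]_(r, n)) : row_free B -> B *m B^T \in unitmx.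
Proof.
move=> freeB; rewrite -row_free_unit -kermx_eq0; apply/eqP/row_matrixP => i.
rewrite row0; set u := row i _.
have uBB : u *m (B *m B^T) = 0 by apply/sub_kermxP; exact: row_sub.
suff uB : u *m B = 0 by apply: (row_free_inj freeB); rewrite uB mul0mx.
have : (u *m B *m (u *m B)^T) 0 0 = 0.
  by rewrite trmx_mul !mulmxA -(mulmxA u) uBB mul0mx mxE.
rewrite mxE => /eqP; rewrite psumr_eq0 => [|j _]; last first.
  by rewrite [(_^T) j 0]mxE -expr2 sqr_ge0.
move=> /allP uB0; apply/rowP => j; rewrite [RHS]mxE; apply/eqP.
by have := uB0 j (mem_index_enum _); rewrite [(_^T) j 0]mxE mulf_eq0 orbb.
Qed.

Lemma exists_pinv m n (A : 'M[R]_(m, n)) : exists X, is_pinv A X.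
Proof.
suff [r [C [B [-> uB uC]]]] : exists r (C : 'M_(m, r)) (B : 'M_(r, n)),
    [/\ A = C *m B, B *m B^T \in unitmx & C^T *m C \in unitmx]; last first.
  exists (\rank A), (col_base A), (row_base A); split; rewrite ?mulmx_base //.
    by apply: gram_unit; exact: row_base_free.
  have := @gram_unit _ _ (col_base A)^T; rewrite trmxK; apply.
  by rewrite /row_free mxrank_tr; exact: col_base_full.
pose GB := invmx (B *m B^T); pose GC := invmx (C^T *m C).
have GBt : GB^T = GB by rewrite trmx_inv trmx_mul trmxK.
have GCt : GC^T = GC by rewrite trmx_inv trmx_mul trmxK.
have GBK : B *m B^T *m GB = 1%:M by rewrite mulmxV.
have GCK : GC *m (C^T *m C) = 1%:M by rewrite mulVmx.
pose X := B^T *m GB *m (GC *m C^T).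
have AX : C *m B *m X = C *m (GC *m C^T).
  rewrite /X -!mulmxA; congr (_ *m _).
  by rewrite (mulmxA B) (mulmxA (B *m _)) GBK mul1mx.
have XA : X *m (C *m B) = B^T *m GB *m B.
  rewrite /X -!mulmxA; congr (_ *m (_ *m _)).
  by rewrite (mulmxA C^T) (mulmxA GC) GCK mul1mx.
exists X; split.
- by rewrite AX -!mulmxA (mulmxA C^T) (mulmxA GC) GCK mul1mx.
- rewrite XA /X -!mulmxA; congr (_ *m (_ *m _)).
  by rewrite (mulmxA B) (mulmxA (B *m _)) GBK mul1mx.
- by rewrite AX !trmx_mul trmxK GCt mulmxA.
- by rewrite XA !trmx_mul trmxK GBt mulmxA.
Qed.

Definition pinv m n (A : 'M[R]_(m, n)) : 'M[R]_(n, m) := sval (cid (exists_pinv A)).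

Lemma pinvP m n (A : 'M[R]_(m, n)) : is_pinv A (pinv A).
Proof. exact: svalP. Qed.

(* Rows and columns of a submatrix are listed in increasing order of the
   original indices, since the enumeration of a set of ordinals is increasing. *)
Definition submatrix n (M : 'M[R]_n) (I J : {set 'I_n}) : 'M[R]_(#|I|, #|J|) :=
  mxsub (fun i : 'I_#|I| => enum_val i) (fun j : 'I_#|J| => enum_val j) M.

Definition schur n (M : 'M[R]_n) (I : {set 'I_n}) : 'M[R]_#|~: I| :=
  submatrix M (~: I) (~: I)
  - submatrix M (~: I) I *m pinv (submatrix M I I) *m submatrix M I (~: I).

(* Column convention: column j holds the coordinates of f e_j. *)
Definition matrix_in n (U : vectType R) (e : n.-tuple U) (f : 'End(U)) : 'M[R]_n :=
  \matrix_(i, j) coord e i (f (tnth e j)).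

End Matrices.

Section Complex.

Variables (R : realType) (d : Order.disp_t) (V : finOrderType d).
Implicit Types (s t : {set V}) (q : nat).

(* The weight is a function on all of {set V}; only its values on the simplices
   matter. *)
Record wcomplex := WComplex {
  simplices : {set {set V}};
  weight : {set V} -> R;
  simplex_neq0 : forall s, s \in simplices -> s != set0;
  simplex_sub : forall s t,
    s \in simplices -> t \subset s -> t != set0 -> t \in simplices;
  weight_gt0 : forall s, s \in simplices -> 0 < weight s }.

Implicit Types K L : wcomplex.

Definition simplicial_pair K L :=
  simplices K \subset simplices L /\ {in simplices K, weight K =1 weight L}.

Definition qsimplices K q := [set s in simplices K | #|s| == q.+1].
Definition nsimp K q := #|qsimplices K q|.

(* All chain spaces are subspaces of the free vector space on {set V}, so that
   C_q^K is literally contained in C_q^L for a pair. R^o is R seen as a vector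
   space over itself. *)
Definition cell s : {ffun {set V} -> R^o} := [ffun t => (t == s)%:R].

Definition chain_space K q : {vspace {ffun {set V} -> R^o}} :=
  <<[seq cell s | s <- enum (qsimplices K q)]>>%VS.

Local Notation chain K q := (subvs_of (chain_space K q)).

Lemma memv_chain K q (c : {ffun {set V} -> R^o}) :
  reflect (forall s, s \notin qsimplices K q -> c s = 0) (c \in chain_space K q).
Proof.
apply: (iffP idP) => [|c0].
  move=> /coord_span -> s sK; rewrite sum_ffunE big1 // => i _.
  set x := _`_i; have : x \in map cell (enum (qsimplices K q)).
    by rewrite mem_nth ?size_tuple ?ltn_ord.
  case/mapP => t; rewrite mem_enum => tK ->; rewrite !ffunE.
  by case: eqP => [st|_]; rewrite ?scaler0 //; rewrite st tK in sK.
have -> : c = \sum_(s in qsimplices K q) c s *: cell s.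
  apply/ffunP => s; rewrite sum_ffunE.
  have [sK|sK] := boolP (s \in qsimplices K q); last first.
    rewrite c0 // big1 // => t tK; rewrite !ffunE.
    by case: eqP => [st|_]; rewrite ?scaler0 //; rewrite st tK in sK.
  rewrite (bigD1 s) //= !ffunE eqxx [_ *: _]mulr1 big1 ?addr0 // => t /andP[_ ts].
  by rewrite !ffunE eq_sym (negPf ts) scaler0.
apply: rpred_sum => s sK; apply: rpredZ; apply: memv_span; apply: map_f.
by rewrite mem_enum.
Qed.

Lemma cell_chain K q s : s \in qsimplices K q -> cell s \in chain_space K q.
Proof. by move=> sK; apply: memv_span; apply: map_f; rewrite mem_enum. Qed.

(* [s] as an element of C_q^K; meaningful only for s in S_q^K. *)
Definition oriented K q s : chain K q := vsproj (chain_space K q) (cell s).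

Lemma orientedK K q s : s \in qsimplices K q -> vsval (oriented K q s) = cell s.
Proof. by move=> sK; rewrite vsprojK ?cell_chain. Qed.

Definition chain_dot K q (c c' : chain K q) : R :=
  \sum_(s in qsimplices K q) (weight K s)^-1 * vsval c s * vsval c' s.

Lemma chain_dot_bilinear K q : bilinear_for *%R (idfun \; *%R) (@chain_dot K q).
Proof.
split=> [v|u] a x y; rewrite /chain_dot /= mulr_sumr -big_split /=;
  apply: eq_bigr => s _; rewrite !ffunE [_ *: _]/(a * _).
  by rewrite mulrDr mulrDl; congr (_ + _); rewrite -!mulrA mulrCA.
by rewrite mulrDr; congr (_ + _); rewrite mulrCA.
Qed.

HB.instance Definition _ K q :=
  bilinear_isBilinear.Build R _ _ _ _ _ (@chain_dot K q) (@chain_dot_bilinear K q).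

Lemma chain_dot_sym K q (u v : chain K q) :
  chain_dot u v = (-1) ^+ false * idfun (chain_dot v u).
Proof. by rewrite mul1r; apply: eq_bigr => s _; rewrite mulrAC. Qed.

HB.instance Definition _ K q :=
  isHermitianSesquilinear.Build R _ false idfun (@chain_dot K q) (@chain_dot_sym K q).

Lemma chain_dot_gt0 K q (u : chain K q) : u != 0 -> 0 < chain_dot u u.
Proof.
have w0 s : s \in qsimplices K q -> 0 < (weight K s)^-1.
  by rewrite inE => /andP[sK _]; rewrite invr_gt0 weight_gt0.
have ge0 s : s \in qsimplices K q -> 0 <= (weight K s)^-1 * vsval u s * vsval u s.
  move=> sK; rewrite -mulrA; apply: mulr_ge0; first exact: ltW (w0 s sK).
  by rewrite -expr2 sqr_ge0.
move=> u0; rewrite lt_def sumr_ge0 // andbT; apply: contra u0.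
rewrite psumr_eq0 // => /allP u0; rewrite -val_eqE; apply/eqP/ffunP => s.
rewrite [RHS]ffunE; have [sK|] := boolP (s \in qsimplices K q); last first.
  by move: s; apply/memv_chain; exact: subvsP.
have := u0 s (mem_index_enum _); rewrite sK -mulrA !mulf_eq0 orbb.
by rewrite gt_eqF ?w0 //= => /eqP.
Qed.

HB.instance Definition _ K q :=
  isDotProduct.Build R _ (@chain_dot K q) (@chain_dot_gt0 K q).

(* s = {v_0 < ... < v_q}, so that v_i has index i in [vertices s]. *)
Definition vertices s : seq V := sort <=%O (enum s).

Definition boundary_simplex L q s : chain L q :=
  \sum_(v in s) (-1) ^+ index v (vertices s) *: oriented L q (s :\ v).

Definition boundary_fun L q (c : chain L q.+1) : chain L q :=
  \sum_(s in qsimplices L q.+1) vsval c s *: boundary_simplex L q s.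

Lemma boundary_fun_linear L q : linear (@boundary_fun L q).
Proof.
move=> a x y; rewrite /boundary_fun scaler_sumr -big_split.
by apply: eq_bigr => s _; rewrite linearP !ffunE /= scalerDl scalerA.
Qed.

HB.instance Definition _ L q :=
  GRing.isLinear.Build _ _ _ _ (@boundary_fun L q) (@boundary_fun_linear L q).

(* The degree is shifted: this is the boundary operator C_(q+1)^L -> C_q^L.
   The zero operator on C_0^L is never involved in an up Laplacian. *)
Definition boundary L q : 'Hom(chain L q.+1, chain L q) :=
  linfun (@boundary_fun L q).

Lemma boundary_oriented L q s : s \in qsimplices L q.+1 ->
  boundary L q (oriented L q.+1 s) = boundary_simplex L q s.
Proof.
move=> sL; rewrite lfunE /= /boundary_fun (bigD1 s) //= orientedK // ffunE eqxx.
rewrite scale1r big1 ?addr0 // => t /andP[_ ts].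
by rewrite ffunE (negPf ts) scale0r.
Qed.

Lemma face_qsimplex L q s v :
  s \in qsimplices L q.+1 -> v \in s -> s :\ v \in qsimplices L q.
Proof.
rewrite !inE => /andP[sL /eqP cs] vs.
have cv : #|s :\ v| = q.+1 by move: (cardsD1 v s); rewrite vs cs => -[].
rewrite cv eqxx andbT (simplex_sub sL) ?subsetDl //.
by rewrite -card_gt0 cv.
Qed.

(* The degree is shifted: this is C_(q+1)^{L,K}, the space of the c in
   C_(q+1)^L with boundary in C_q^K. *)
Definition pers_chain_space K L q : {vspace chain L q.+1} :=
  (linfun (vsval \o boundary L q) @^-1: chain_space K q)%VS.

Lemma mem_pers_chain K L q c :
  (c \in pers_chain_space K L q) = (vsval (boundary L q c) \in chain_space K q).
Proof. by rewrite -memv_preim lfunE. Qed.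

Local Notation pers_chain K L q := (subvs_of (pers_chain_space K L q)).

Definition pers_boundary K L q : 'Hom(pers_chain K L q, chain K q) :=
  linfun (vsproj (chain_space K q) \o (vsval \o (boundary L q \o vsval))).

Lemma pers_boundaryE K L q (c : pers_chain K L q) :
  vsval (pers_boundary K L q c) = vsval (boundary L q (vsval c)).
Proof. by rewrite lfunE /= vsprojK // -mem_pers_chain subvsP. Qed.

Definition up_laplacian L q : 'End(chain L q) :=
  (boundary L q \o adjoint (@chain_dot L q.+1) (@chain_dot L q) (boundary L q))%VF.

Definition up_pers_laplacian K L q : 'End(chain K q) :=
  (pers_boundary K L q
   \o adjoint (@restr_dot _ _ (@chain_dot L q.+1) (pers_chain_space K L q))
              (@chain_dot K q) (pers_boundary K L q))%VF.

(* An ordering of S_q^L (0-based) listing S_q^K first. *)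
Definition simplex_ordering K L q (sigma : 'I_(nsimp L q) -> {set V}) :=
  [/\ injective sigma,
      [set sigma i | i in 'I_(nsimp L q)] = qsimplices L q
    & [set sigma i | i in 'I_(nsimp L q) & (i < nsimp K q)%N] = qsimplices K q].

Definition chain_basis K q n (sigma : 'I_n -> {set V}) : n.-tuple (chain K q) :=
  [tuple oriented K q (sigma i) | i < n].

Lemma chain_basisP K q (sigma : 'I_(nsimp K q) -> {set V}) :
  injective sigma -> [set sigma i | i in 'I_(nsimp K q)] = qsimplices K q ->
  basis_of {:chain K q} (chain_basis K q sigma).
Proof.
move=> sigma_inj sigmaK; pose e := chain_basis K q sigma.
have sK i : sigma i \in qsimplices K q by rewrite -sigmaK imset_f.
have eE (i : 'I_(nsimp K q)) : e`_i = oriented K q (sigma i).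
  by rewrite -tnth_nth tnth_mktuple.
have sumE k (j : 'I_(nsimp K q)) :
    vsval (\sum_(i < nsimp K q) k i *: e`_i) (sigma j) = k j.
  rewrite linear_sum sum_ffunE (bigD1 j) //= eE ?linearZ /= orientedK // !ffunE.
  rewrite eqxx [_ *: _]mulr1 big1 ?addr0 // => i ij.
  rewrite eE ?linearZ /= orientedK // !ffunE (inj_eq sigma_inj) eq_sym.
  by rewrite (negPf ij) scaler0.
have freee : free e.
  by apply/freeP => k k0 i; rewrite -(sumE k) k0 linear0 ffunE.
rewrite /basis_of freee andbT eqEsubv subvf /=; apply/subvP => c _.
suff -> : c = \sum_(i < nsimp K q) vsval c (sigma i) *: e`_i.
  apply: rpred_sum => i _; apply: rpredZ; apply: memv_span.
  by rewrite mem_nth // size_tuple.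
apply: val_inj; apply/ffunP => s.
have [|sNK] := boolP (s \in qsimplices K q).
  by rewrite -sigmaK => /imsetP[i _ ->]; rewrite sumE.
by rewrite !(elimT (memv_chain _ _ _) (subvsP _)).
Qed.

Definition up_laplacian_mx L q (sigma : 'I_(nsimp L q) -> {set V}) :
    'M[R]_(nsimp L q) :=
  matrix_in (chain_basis L q sigma) (up_laplacian L q).

Definition up_pers_laplacian_mx K L q (leKL : (nsimp K q <= nsimp L q)%N)
    (sigma : 'I_(nsimp L q) -> {set V}) : 'M[R]_(nsimp K q) :=
  matrix_in (chain_basis K q (sigma \o widen_ord leKL)) (up_pers_laplacian K L q).

End Complex.

(* The indices [n] \ [k] (0-based). *)
Definition index_compl k n : {set 'I_n} := [set i : 'I_n | (k <= i)%N].

Lemma card_index_compl k n : (k <= n)%N -> k = #|~: index_compl k n|.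
Proof.
move=> lekn; have -> : ~: index_compl k n = widen_ord lekn @: setT.
  apply/setP => i; rewrite !inE -ltnNge; apply/idP/imsetP => [ltik|[j _ ->]]; last exact: ltn_ord j.
  by exists (Ordinal ltik) => //; apply: val_inj.
rewrite card_imset ?cardsT ?card_ord //.
by move=> i j /(congr1 val)/= eqij; apply: val_inj.
Qed.

Arguments up_laplacian_mx {R d V} L q sigma.
Arguments up_pers_laplacian_mx {R d V} K L q leKL sigma.
Arguments simplex_ordering {R d V} K L q sigma.

(* Main.v *)
Require Import Defs.
From mathcomp Require Import all_boot all_order all_algebra.
From mathcomp Require Import reals.

(** Write D for the up Laplacian of L in degree q, B for the boundary map from
    degree q+1 to degree q of L, so that D = B B^*, and I for the set of indices
    of the q-simplices of L outside K.

    The persistent Laplacian of a chain c of K is D z for any chain z of L that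
    extends c (z agrees with c on the simplices of K) and for which D z is a
    chain of K (lemma [up_pers_laplacianE]).  Indeed B^* z is then a persistent
    chain, and since a persistent chain u has its boundary in K, pairing that
    boundary with z or with c gives the same number; hence B^* z is the image of
    c under the adjoint of the persistent boundary, and D z = B (B^* z).

    In coordinates, extending a basis chain e_j of K means choosing the
    coefficients y of z on I, and D z is a chain of K iff
    D(I,I) y = - D(I,j).  When this system is solvable,
    y = - D(I,I)^+ D(I,j) is a solution, where ^+ is the Moore-Penrose inverse;
    the coordinates of D z on K are then D(K,j) - D(K,I) D(I,I)^+ D(I,j), which is
    column j of the Schur complement.

    It is solvable because D is a Gram operator (lemma
    [submatrix_gram_range]): a row vector killing D(I,I) on the left is,
    once rescaled by the weights, a chain z supported on I with <B^* z, B^* z> = 0, hence with B^* z = 0, so it kills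
    every column of D(I,-).  The weights make the matrix of D non-symmetric,
    while the Moore-Penrose inverse refers to the standard inner product; this
    does no harm, as only D(I,I) D(I,I)^+ D(I,I) = D(I,I) enters. *)

Set Implicit Arguments.
Unset Strict Implicit.
Unset Printing Implicit Defensive.

Import Order.TTheory GRing.Theory Num.Theory.
Local Open Scope ring_scope.

Section Adjoints.

Variables (R : realType) (U W : vectType R).
Variables (dU : {dot U for idfun}) (dW : {dot W for idfun}).

Lemma dot_eq0 (u : U) : dU u u = 0 -> u = 0.
Proof.
move=> u0; apply/eqP/negPn/negP => /(@neq0_dnorm_gt0 _ _ _ dU).
by rewrite u0 ltxx.
Qed.

(** Pairing with all vectors of U determines the value of the adjoint; this is
    how the adjoint, known only through its existence, gets computed. *)
Lemma adjoint_eq (f : 'Hom(U, W)) (w : W) (p : U) :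
  (forall u, dW (f u) w = dU u p) -> adjoint dU dW f w = p.
Proof.
move=> fp; apply/eqP; rewrite -subr_eq0; apply/eqP/dot_eq0.
by rewrite linearBr /= -(adjointP dU dW) fp subrr.
Qed.

Lemma dot_gram (f : 'Hom(U, W)) (w w' : W) :
  dW ((f \o adjoint dU dW f)%VF w) w'
  = dU (adjoint dU dW f w) (adjoint dU dW f w').
Proof. by rewrite comp_lfunE (adjointP dU dW). Qed.

(** The columns of M(I, J) lie in the column space of M(I, I), as for a positive
    semidefinite matrix.  For a basis e, the hypothesis on [coord] says that e is
    orthogonal, [lambda i] being the inverse of the squared norm of its i-th
    vector; M is then a symmetric matrix only up to a diagonal scaling.  Since M(I, I) times its pseudo-inverse fixes M(I, I) on
    the left, it is enough that the left kernel of M(I, I) kills M(I, J). *)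
Lemma submatrix_gram_range n (e : n.-tuple W) (lambda : 'I_n -> R)
    (f : 'Hom(U, W)) (I J : {set 'I_n}) :
  (forall i c, coord e i c = lambda i * dW c (tnth e i)) ->
  let M := matrix_in e (f \o adjoint dU dW f)%VF in
  submatrix M I I *m pinv (submatrix M I I) *m submatrix M I J
  = submatrix M I J.
Proof.
move=> coordE M; set A := submatrix M I I; set B := submatrix M I J.
have ME i j : M i j = lambda i * dW ((f \o adjoint dU dW f)%VF (tnth e j)) (tnth e i).
  by rewrite mxE coordE.
have kerAB (u : 'rV_#|I|) : u *m A = 0 -> u *m B = 0.
  move=> uA0.
  (* The scaling by lambda turns u times a column of M into a pairing with z;
     z is kept opaque so that only chosen occurrences get expanded. *)
  have [z zE] : exists z, z =
      \sum_(i < #|I|) (u 0 i * lambda (enum_val i)) *: tnth e (enum_val i).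
    by eexists.
  have dotz j : dW ((f \o adjoint dU dW f)%VF (tnth e j)) z
              = \sum_(i < #|I|) u 0 i * M (enum_val i) j.
    rewrite zE linear_sumr; apply: eq_bigr => i _.
    by rewrite linearZr_LR /= ME mulrA.
  have fz0 : adjoint dU dW f z = 0.
    apply: dot_eq0; rewrite -dot_gram {1}zE linear_sum linear_sumlz.
    apply: big1 => j _; rewrite linearZ linearZl_LR /= dotz.
    move: uA0 => /rowP/(_ j); rewrite !mxE.
    under eq_bigr do rewrite mxE.
    by move=> ->; rewrite mulr0.
  apply/rowP => j; rewrite !mxE; under eq_bigr do rewrite mxE.
  by rewrite -dotz dot_gram fz0 linear0r.
have [AXA _ _ _] := pinvP A.
apply/esym/eqP; rewrite -subr_eq0 -{1}[B]mul1mx -mulmxBl; apply/eqP/row_matrixP => r.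
rewrite row_mul row0; apply: kerAB.
by rewrite -row_mul mulmxBl mul1mx AXA subrr row0.
Qed.

End Adjoints.

(** The complement of [index_compl k n] is the initial segment of length k,
    listed in increasing order, so the i-th row of the Schur complement belongs to
    the i-th simplex. *)
Lemma val_enum_val_index_compl k n (i : 'I_#|~: index_compl k n|) :
  (k <= n)%N -> val (enum_val i) = i :> nat.
Proof.
move=> lekn; have i0 := enum_default i.
have enumE : map val (enum (~: index_compl k n)) = iota 0 k.
  rewrite {1}/enum_mem -enumT (eq_filter (a2 := preim val (fun m => m < k)%N)).
    by rewrite -filter_map val_enum_ord (filter_iota_ltn 0 lekn).
  by move=> j /=; rewrite !inE -ltnNge.
have lti : (i < #|~: index_compl k n|)%N := ltn_ord i.
rewrite (enum_val_nth i0) -(nth_map _ 0%N) -?cardE // enumE nth_iota ?add0n //.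
by rewrite [X in (_ < X)%N](card_index_compl lekn).
Qed.

Section Chains.

Variables (R : realType) (d : Order.disp_t) (V : finOrderType d).
Implicit Types (K L : wcomplex R V) (q : nat).

Local Notation chain K q := (subvs_of (chain_space K q)).

Lemma coord_chain_basis L q n (sigma : 'I_n -> {set V}) (i : 'I_n) (c : chain L q) :
  injective sigma -> [set sigma i | i in 'I_n] = qsimplices L q ->
  coord (chain_basis L q sigma) i c = vsval c (sigma i).
Proof.
move=> sigma_inj sigmaL.
have nE : n = nsimp L q by rewrite /nsimp -sigmaL card_imset ?card_ord.
subst n; have sL j : sigma j \in qsimplices L q by rewrite -sigmaL imset_f.
have eE (j : 'I_(nsimp L q)) :
    (chain_basis L q sigma)`_j = oriented L q (sigma j).
  by rewrite -tnth_nth tnth_mktuple.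
rewrite [in RHS](coord_basis (chain_basisP sigma_inj sigmaL) (memvf c)).
under [in RHS]eq_bigr => j _ do rewrite eE.
rewrite linear_sum sum_ffunE (bigD1 i) //= orientedK // !ffunE eqxx.
rewrite [_ *: _]mulr1 big1 ?addr0 // => j ji.
rewrite orientedK // !ffunE (inj_eq sigma_inj).
by rewrite eq_sym (negPf ji) scaler0.
Qed.

Lemma chain_dot_oriented L q s (c : chain L q) : s \in qsimplices L q ->
  chain_dot c (oriented L q s) = (weight L s)^-1 * vsval c s.
Proof.
move=> sL; rewrite /chain_dot (bigD1 s) //= orientedK // ffunE eqxx mulr1.
rewrite big1 ?addr0 // => t /andP[_ ts].
by rewrite ffunE (negPf ts) mulr0.
Qed.

(** The adjoint of the persistent boundary projects the adjoint of the boundary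
    onto the persistent chains.  Correcting c outside K so that the adjoint of
    the boundary already lands there makes the projection disappear. *)
Lemma up_pers_laplacianE K L q (c : chain K q) (z : chain L q) :
  simplicial_pair K L ->
  {in qsimplices K q, vsval z =1 vsval c} ->
  vsval (up_laplacian L q z) \in chain_space K q ->
  vsval (up_pers_laplacian K L q c) = vsval (up_laplacian L q z).
Proof.
move=> [sKL wKL] zc DzK.
have pP : adjoint (@chain_dot R d V L q.+1) (@chain_dot R d V L q) (boundary L q) z
    \in pers_chain_space K L q.
  by rewrite mem_pers_chain; move: DzK; rewrite /up_laplacian comp_lfunE.
have subq s : s \in qsimplices K q -> s \in qsimplices L q.
  by rewrite !inE => /andP[/(subsetP sKL) -> ->].
rewrite /up_pers_laplacian comp_lfunE pers_boundaryE /up_laplacian comp_lfunE.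
congr (vsval (boundary L q _)).
rewrite (@adjoint_eq _ _ _ _ _ _ _ (Subvs pP)) // => u.
rewrite /= /restr_dot /= -(adjointP (@chain_dot R d V L q.+1)).
have /memv_chain uK : vsval (boundary L q (vsval u)) \in chain_space K q.
  by rewrite -mem_pers_chain subvsP.
apply/esym; rewrite /chain_dot /= [LHS](bigID (mem (qsimplices K q))) /= [X in _ + X]big1 ?addr0.
  apply: eq_big => [s|s /andP[_ sK]].
    by apply/andP/idP => [[]|sK] //; split=> //; exact: subq.
  by rewrite pers_boundaryE zc // -wKL //; move: sK; rewrite inE => /andP[].
by move=> s /andP[_ sK]; rewrite uK // mulr0 mul0r.
Qed.

End Chains.

Theorem theorem4p6 (R : realType) (d : Order.disp_t) (V : finOrderType d)
    (K L : wcomplex R V) (q : nat)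
    (sigma : 'I_(nsimp L q) -> {set V}) :
  simplicial_pair K L ->
  simplex_ordering K L q sigma ->
  forall ltKL : (nsimp K q < nsimp L q)%N,
  let n_eq := card_index_compl (ltnW ltKL) in
  castmx (n_eq, n_eq) (up_pers_laplacian_mx K L q (ltnW ltKL) sigma)
  = schur (up_laplacian_mx L q sigma) (index_compl (nsimp K q) (nsimp L q)).
Proof.
move=> pairKL [sigma_inj sigmaL sigmaK] ltKL n_eq.
set n := nsimp L q in sigma sigma_inj sigmaL sigmaK ltKL n_eq *.
set k := nsimp K q in sigmaK ltKL n_eq *.
set M := up_laplacian_mx L q sigma; set I := index_compl k n.
set tau := sigma \o widen_ord (ltnW ltKL).
have sL i : sigma i \in qsimplices L q by rewrite -sigmaL imset_f.
have sK i : (sigma i \in qsimplices K q) = (i < k)%N.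
  rewrite -sigmaK; apply/imsetP/idP => [[j + /sigma_inj ->]|ik].
    by rewrite inE => /andP[].
  by exists i; rewrite // inE ik andbT.
have tau_inj : injective tau.
  by move=> i j /sigma_inj/(congr1 val)/= eqij; apply: val_inj.
have tauK : [set tau i | i in 'I_k] = qsimplices K q.
  rewrite -sigmaK; apply/setP => s; apply/imsetP/imsetP => [[i _ ->]|[i]].
    by exists (widen_ord (ltnW ltKL) i); rewrite // inE /= ltn_ord.
  by rewrite inE => /andP[_ ik] ->; exists (Ordinal ik) => //; congr sigma; apply: val_inj.
have ME i j : M i j = vsval (up_laplacian L q (oriented L q (sigma j))) (sigma i).
  by rewrite mxE coord_chain_basis // tnth_mktuple.
have rangeM : submatrix M I I *m pinv (submatrix M I I) *m submatrix M I (~: I)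
            = submatrix M I (~: I).
  apply: (@submatrix_gram_range _ _ _ _ _ _ _ (fun i => weight L (sigma i))) => i c.
  rewrite coord_chain_basis // tnth_mktuple /= chain_dot_oriented // mulVKf //.
  by rewrite gt_eqF // weight_gt0 //; move: (sL i); rewrite inE => /andP[].
apply/matrixP => i j; rewrite castmxE mxE coord_chain_basis // tnth_mktuple.
have tauE a : tau (cast_ord (esym n_eq) a) = sigma (enum_val a).
  congr sigma; apply: val_inj.
  by rewrite /= (val_enum_val_index_compl a (ltnW ltKL)).
rewrite -/tau !tauE.
(* The coefficients -Y outside K solve D(I,I) y = - D(I,j). *)
pose Y := pinv (submatrix M I I) *m submatrix M I (~: I).
pose z := oriented L q (sigma (enum_val j))
  - \sum_(a < #|I|) Y a j *: oriented L q (sigma (enum_val a)).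
have DzE b : vsval (up_laplacian L q z) (sigma b)
           = M b (enum_val j) - \sum_(a < #|I|) M b (enum_val a) * Y a j.
  rewrite /z linearB linear_sum ME /= 2!ffunE; congr (_ - _).
  rewrite linear_sum sum_ffunE; apply: eq_bigr => a _.
  by rewrite ME linearZ linearZ /= ffunE [_ *: _]mulrC.
have ltjk : (enum_val j < k)%N.
  by move: (enum_valP j); rewrite !inE -ltnNge.
rewrite (@up_pers_laplacianE _ _ _ K L q _ z) //.
- rewrite DzE /schur -mulmxA -/Y [RHS]mxE; congr (_ + _).
    by rewrite [RHS]mxE.
  rewrite [RHS]mxE [in RHS]mxE; congr (- _); apply: eq_bigr => a _.
  by congr (_ * _); rewrite [RHS]mxE.
- move=> s; rewrite -tauK => /imsetP[b _ ->].
  rewrite /z linearB /= linear_sum orientedK // orientedK ?sK // 3!ffunE.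
  rewrite sum_ffunE big1 ?oppr0 ?addr0 // => a _.
  rewrite linearZ /= orientedK // !ffunE (inj_eq sigma_inj).
  case: eqP => [ba|_]; last by rewrite scaler0.
  by have := enum_valP a; rewrite -ba inE /= leqNgt ltn_ord.
apply/memv_chain => s sNK; have [|sNL] := boolP (s \in qsimplices L q); last first.
  by apply: (elimT (memv_chain _ _ _) (subvsP _)).
rewrite -sigmaL => /imsetP[b _ sb]; rewrite sb DzE.
(* Outside K the coordinates of D z are the residual of the system solved
   by -Y, which vanishes by rangeM. *)
have bI : b \in I by rewrite inE leqNgt -sK -sb.
have rangeb : (submatrix M I I *m Y) (enum_rank_in bI b) j = M b (enum_val j).
  by rewrite mulmxA rangeM mxE enum_rankK_in.
apply/eqP; rewrite -rangeb subr_eq0 mxE; apply/eqP/eq_bigr => a _.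
by congr (_ * _); rewrite mxE enum_rankK_in.
Qed.
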